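(* The elements $x_1,\dots,x_N\in S(\mathfrak{g}_e)$ defined below are algebraically independent generators of the invariant algebra $S(\mathfrak{g}_e)^{\mathfrak{g}_e}$ for the adjoint action of $\mathfrak{g}_e$ on its symmetric algebra.
   Context: $F$ is an algebraically closed field of characteristic zero; $\lambda=(\lambda_1,\dots,\lambda_n)$ is a composition of $N$ with positive parts and $\lambda_1\le\cdots\le\lambda_n$; $s_{i,j}:=\lambda_j-\min(\lambda_i,\lambda_j)$. $e\in\mathfrak{g}=\mathfrak{gl}_N(F)$ is the nilpotent matrix with Jordan blocks $\lambda_1,\dots,\lambda_n$ down the diagonal and $\mathfrak{g}_e$ its centralizer. With the diagram whose row $i$ has $\lambda_i$ boxes, filled with $1,\dots,N$ along rows, and $\mathrm{row}(h),\mathrm{col}(h)$ the row/column of $h$, set $e_{i,j;r}:=\sum_{\mathrm{row}(h)=i,\mathrm{row}(k)=j,\mathrm{col}(k)-\mathrm{col}(h)=r}e_{h,k}$ ($e_{h,k}$ matrix units) for $s_{i,j}\le r<\lambda_j$; these form a basis of $\mathfrak{g}_e$. $(d_1,\dots,d_N)$ consists of $\lambda_n$ copies of $1$, then $\lambda_{n-1}$ copies of $2$, ..., then $\lambda_1$ copies of $n$. For $\mu\subseteq\lambda$ ($0\le\mu_i\le\lambda_i$), $|\mu|=\sum\mu_i$, $\ell(\mu)$ = number of nonzero parts. For $r=1,\dots,N$, with $d=d_r$, $x_r:=\sum_{\mu\subseteq\lambda,\ |\mu|=r,\ \ell(\mu)=d}\sum_{w\in S_d}\mathrm{sgn}(w)\,e_{i_{w1},i_1;\mu_{i_1}-1}\cdots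 e_{i_{wd},i_d;\mu_{i_d}-1}\in S(\mathfrak{g}_e)$, where $i_1<\cdots<i_d$ are the positions of the nonzero entries of $\mu$. *)

(* Defs.v *)
From HB Require Import structures.
From mathcomp Require Import all_boot all_order all_algebra all_fingroup.
From mathcomp Require Import mpoly.
Set Implicit Arguments. Unset Strict Implicit. Unset Printing Implicit Defensive.
Import GRing.Theory.
Local Open Scope ring_scope.

(* Setting: lam = (lambda_1,...,lambda_n) as a seq nat; rows are 0-indexed
   ('I_n), boxes of the diagram are 0-indexed ('I_N), filled along rows. *)
Section Centralizer.
Variable (F : fieldType) (lam : seq nat).

Definition nrows := size lam.
Definition Nsz := sumn lam.
Definition lm (i : nat) : nat := nth 0%N lam i.
Definition sij (i j : nat) : nat := (lm j - minn (lm i) (lm j))%N.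
Definition pre (i : nat) : nat := sumn (take i lam).
Definition row (h : nat) : nat := count (fun i => pre i.+1 <= h)%N (iota 0 nrows).
Definition col (h : nat) : nat := (h - pre (row h))%N.

Definition Emat (i j r : nat) : 'M[F]_Nsz :=
  \matrix_(h < Nsz, k < Nsz)
    ((row h == i) && (row k == j) && (col k == col h + r)%N)%:R.

(* index set of the basis {e_{i,j;r} : s_{i,j} <= r < lambda_j} of g_e *)
Definition isb (t : 'I_nrows * 'I_nrows * 'I_Nsz) : bool :=
  (sij t.1.1 t.1.2 <= t.2 < lm t.1.2)%N.
Definition Bidx := {t : 'I_nrows * 'I_nrows * 'I_Nsz | isb t}.
Definition bi (b : Bidx) : nat := (val b).1.1.
Definition bj (b : Bidx) : nat := (val b).1.2.
Definition br (b : Bidx) : nat := (val b).2.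
Definition Eb (b : Bidx) : 'M[F]_Nsz := Emat (bi b) (bj b) (br b).

Definition dimge := #|{: Bidx}|.
Definition Sge := {mpoly F[dimge]}.
Definition Xb (b : Bidx) : Sge := 'X_(enum_rank b).

(* coordinate of A in g_e along e_{i,j;r}: the matrix units occurring in the
   different basis elements are pairwise distinct, and e_{i,j;r} always
   contains e_{h,k} with k the last box of row j and h the box of row i in
   column lambda_j - 1 - r (0-indexed); so the coordinate is that entry. *)
Definition hbox (b : Bidx) : nat := (pre (bi b) + (lm (bj b) - 1 - br b))%N.
Definition kbox (b : Bidx) : nat := (pre (bj b) + lm (bj b) - 1)%N.
Definition coord (b : Bidx) (A : 'M[F]_Nsz) : F :=
  \sum_(h < Nsz) \sum_(k < Nsz)
     (if (val h == hbox b) && (val k == kbox b) then A h k else 0).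
(* the identification g_e = S^1(g_e) *)
Definition lin (A : 'M[F]_Nsz) : Sge := \sum_(d : Bidx) coord d A *: Xb d.

(* adjoint action of e_b on S(g_e): the derivation extending y |-> [e_b, y] *)
Definition adS (b : Bidx) (f : Sge) : Sge :=
  \sum_(c : Bidx) mderiv (enum_rank c) f * lin (Eb b *m Eb c - Eb c *m Eb b).
(* f in S(g_e)^{g_e} (invariance under a basis is invariance under g_e, by
   linearity of the action in the acting element) *)
Definition ge_invariant (f : Sge) : Prop := forall b : Bidx, adS b f = 0.

(* e_{i,j;r} as an element of S(g_e); zero when (i,j,r) is not a basis index *)
Definition Xe (i j r : nat) : Sge :=
  \sum_(b : Bidx | (bi b == i) && (bj b == j) && (br b == r)) Xb b.

Definition dseq : seq nat :=
  flatten [seq nseq (lm (nrows - k)) k | k <- iota 1 nrows].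
Definition dr (r : nat) : nat := nth 0%N dseq r.-1.

Definition Mu := {ffun 'I_nrows -> 'I_Nsz.+1}.
Definition subl (mu : Mu) : bool := [forall i, (mu i <= lm i)%N].
Definition msize (mu : Mu) : nat := \sum_(i < nrows) val (mu i).
Definition mlen (mu : Mu) : nat := #|[set i | val (mu i) != 0%N]|.
Definition mun (mu : Mu) (i : nat) : nat :=
  \sum_(k < nrows | val k == i) val (mu k).
Definition mpos (mu : Mu) : seq nat :=
  [seq val i | i <- enum 'I_nrows & val (mu i) != 0%N].

Definition xr (r : nat) : Sge :=
  let d := dr r in
  \sum_(mu : Mu | [&& subl mu, msize mu == r & mlen mu == d])
    \sum_(w : 'S_d)
      (-1) ^+ w *
      \prod_(k < d)
        Xe (nth 0%N (mpos mu) (w k)) (nth 0%N (mpos mu) k)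
           (mun mu (nth 0%N (mpos mu) k) - 1).

Definition xs : Nsz.-tuple Sge := [tuple xr i.+1 | i < Nsz].

End Centralizer.

(* Main.v *)
(* Put A_ij(u) = sum_t e_{i,j;t-1} u^t.  Since x_r collects the minors of the
   smallest possible size, it is the coefficient of z^(n-d) u^r in det(z + A(u)).

   Invariance: the derivation ad(e_{a,b;s}) acts on z + A(u) as a row operation
   minus a column operation, up to truncation terms of bounded degree in u; the
   row and column operations cancel in the determinant, and the degree bound
   shows that the truncation terms cannot reach the exponent s + r.

   Independence and generation: restrict functions on the dual of g_e to the
   affine slice where e_{n,j;t} is free, e_{i,i+1;lambda_{i+1}-1} = 1 for i < n and
   all other e_{i,j;t} with i < n vanish.  There z + A(u) is a companion matrix,
   so, up to signs, x_1, ..., x_N restrict to the N coordinates of the slice.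
   Restriction is injective on invariants because the slice is transverse to the
   coadjoint orbits: for an invariant vanishing on the slice, the term of lowest
   order transverse to the slice has zero transverse derivatives, hence vanishes
   in characteristic 0. *)
Require Import Defs.
From HB Require Import structures.
From mathcomp Require Import all_boot all_order all_algebra all_fingroup.
From mathcomp Require Import mpoly zify.
Set Implicit Arguments. Unset Strict Implicit. Unset Printing Implicit Defensive.
Import GRing.Theory.
Local Open Scope ring_scope.

(** * Determinants *)

(** Both sides are the determinant of the block matrix with rows [(1, U)] and [(-V, 1)], factored
    once as lower times upper triangular and once as upper times lower. *)
Lemma det_sylvester (R : comNzRingType) (m n : nat)
    (U : 'M[R]_(m, n)) (V : 'M[R]_(n, m)) :
  \det (1%:M + U *m V) = \det (1%:M + V *m U).
Proof.
have E1 : block_mx 1%:M 0 (- V) 1%:M *m block_mx 1%:M U 0 (1%:M + V *m U)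
   = block_mx 1%:M U (- V) 1%:M.
  by rewrite mulmx_block !mul1mx ?mulmx1 !mul0mx ?mulmx0 !addr0 mulNmx addrCA
             addNr addr0.
have E2 : block_mx (1%:M + U *m V) U 0 1%:M *m block_mx 1%:M 0 (- V) 1%:M
   = block_mx 1%:M U (- V) 1%:M.
  by rewrite mulmx_block ?mul1mx !mulmx1 ?mul0mx !mulmx0 !add0r mulmxN addrK.
have := congr1 (fun A => \det A) (etrans E2 (esym E1)).
by rewrite !det_mulmx !det_lblock !det_ublock !det1 !mulr1 !mul1r.
Qed.

(** This reduces a determinant of size [n] to the minor on the support of [mu], because a column
    with [mu j = 0] will be a unit vector. *)
Lemma det_unit_cols (R : comNzRingType) (n d : nat) (C : 'M[R]_n)
    (p : 'I_d -> 'I_n) :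
  injective p -> (forall i j, j \notin codom p -> C i j = (i == j)%:R) ->
  \det C = \det (mxsub p p C).
Proof.
move=> p_inj Cid.
pose P : 'M[R]_(d, n) := \matrix_(k, j) (j == p k)%:R.
have PPt : P *m P^T = 1%:M.
  apply/matrixP=> k l; rewrite !mxE (bigD1 (p k)) //= big1 ?addr0 => [|j].
    by rewrite !mxE eqxx mul1r (inj_eq p_inj).
  by rewrite !mxE => /negPf->; rewrite mul0r.
have rowP m' (B : 'M[R]_(n, m')) k j : (P *m B) k j = B (p k) j.
  rewrite !mxE (bigD1 (p k)) //= big1 ?addr0 => [|i]; rewrite !mxE ?eqxx ?mul1r //.
  by move=> /negPf->; rewrite mul0r.
have colPt m' (B : 'M[R]_(m', n)) i k : (B *m P^T) i k = B i (p k).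
  rewrite !mxE (bigD1 (p k)) //= big1 ?addr0 => [|j]; rewrite !mxE ?eqxx ?mulr1 //.
  by move=> /negPf->; rewrite mulr0.
(* C - 1 vanishes on the columns outside the image of p, so Sylvester's identity
   applies with the projection P^T *m P. *)
have CE : C = 1%:M + (C - 1%:M) *m P^T *m P.
  apply/matrixP=> i j; have [/codomP[k ->]|jp] := boolP (j \in codom p).
    rewrite mxE [X in _ + X]mxE (bigD1 k) //= big1 ?addr0 => [|l].
      by rewrite colPt !mxE eqxx mulr1 addrC subrK.
    by rewrite eq_sym !mxE => lk; rewrite (inj_eq p_inj) (negPf lk) mulr0.
  rewrite mxE [X in _ + X]mxE big1 ?addr0 => [|k _]; first by rewrite mxE Cid.
  rewrite [P k j]mxE; have [jk|] := eqVneq j (p k); last by rewrite mulr0.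
  by rewrite jk codom_f in jp.
rewrite {1}CE det_sylvester; congr (\det _).
apply/matrixP=> k l; rewrite [LHS]mxE [X in _ + X]rowP colPt !mxE (inj_eq p_inj).
by rewrite addrC subrK.
Qed.

Lemma eq_cofactor (R : comNzRingType) (n : nat) (A B : 'M[R]_n) i j :
  (forall k l, k != i -> l != j -> A k l = B k l) -> cofactor A i j = cofactor B i j.
Proof.
move=> eqAB; rewrite /cofactor; congr (_ * \det _).
by apply/matrixP=> k l; rewrite !mxE eqAB // eq_sym neq_lift.
Qed.

Section DetExpand.
Variables (S : comNzRingType) (n T : nat).
Implicit Type g : 'I_n -> 'I_n -> nat -> S.

(* The outer variable of {poly {poly S}} is z, the inner one is u. *)
Definition zu_mono (t : nat) : {poly {poly S}} := if t == 0%N then 'X else ('X^t)%:P.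

(** Slot [t = 0] stands for [z] and slot [t > 0] for [u^t]. A choice of one monomial per column is
    then a single function [mu], whose zero parts count the powers of [z]. *)
Definition zu_mx g : 'M[{poly {poly S}}]_n :=
  \matrix_(i, j) \sum_(t < T.+1) (g i j t)%:P%:P * zu_mono t.

Lemma zu_mxE g i j :
  zu_mx g i j = (g i j 0%N)%:P%:P * 'X
               + (\poly_(t < T.+1) (if t == 0%N then 0 else g i j t))%:P.
Proof.
rewrite mxE big_ord_recl /= /zu_mono eqxx; congr (_ + _).
rewrite poly_def rmorph_sum /= big_ord_recl /= scale0r polyC0 add0r.
by apply: eq_bigr => t _; rewrite /= -mul_polyC polyCM.
Qed.

Lemma eq_zu_mx g g' i j :
  (forall t, g i j t = g' i j t) -> zu_mx g i j = zu_mx g' i j.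
Proof. by move=> eqg; rewrite !mxE; apply: eq_bigr => t _; rewrite eqg. Qed.

Lemma prod_zu_mono (f : 'I_n -> nat) :
  \prod_j zu_mono (f j) = 'X^(#|[set j | f j == 0%N]|) * ('X^(\sum_j f j))%:P.
Proof.
have -> : #|[set j | f j == 0%N]| = (\sum_j (f j == 0%N : nat))%N.
  by rewrite -sum1dep_card big_mkcond /=; apply: eq_bigr => j _; case: eqP.
rewrite -!prodrXr rmorph_prod -big_split /=; apply: eq_bigr => j _.
by rewrite /zu_mono; case: eqP => [->|_]; rewrite ?expr0 ?mulr1 ?mul1r.
Qed.

(** Multilinearity in the columns: column [j] picks the monomial of slot [mu j], and these monomials
    multiply to a power of [z] counting the zero parts times a power of [u] adding up the parts. *)
Lemma det_zu_mx g k r :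
  ((\det (zu_mx g))`_k)`_r =
  \sum_(mu : {ffun 'I_n -> 'I_T.+1} |
        (#|[set j | mu j == 0%N :> nat]| == k) && ((\sum_j mu j)%N == r))
     \det (\matrix_(i, j) g i j (mu j)).
Proof.
have -> : \det (zu_mx g) = \sum_(mu : {ffun 'I_n -> 'I_T.+1})
    (\det (\matrix_(i, j) g i j (mu j)))%:P%:P *
    ('X^(#|[set j | mu j == 0%N :> nat]|) * ('X^(\sum_j mu j))%:P).
  (* After transposition the product attached to a permutation runs over the columns, by which [mu]
     is indexed. *)
  rewrite -det_tr; transitivity (\sum_(s : 'S_n) \sum_(mu : {ffun 'I_n -> 'I_T.+1})
     ((-1) ^+ s * \prod_j g (s j) j (mu j))%:P%:P * \prod_j zu_mono (mu j)).
    apply: eq_bigr => s _.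
    rewrite (eq_bigr (fun j => \sum_(t < T.+1) (g (s j) j t)%:P%:P * zu_mono t)); last first.
      by move=> j _; rewrite !mxE.
    rewrite bigA_distr_bigA /= mulr_sumr; apply: eq_bigr => mu _.
    by rewrite big_split /= mulrA !rmorphM !rmorph_sign !rmorph_prod.
  rewrite exchange_big /=; apply: eq_bigr => mu _.
  rewrite -mulr_suml prod_zu_mono; congr (_ * _).
  rewrite -det_tr !rmorph_sum /=; apply: eq_bigr => s _; do 3 f_equal.
  by apply: eq_bigr => j _; rewrite !mxE.
rewrite !coef_sum big_mkcond [RHS]big_mkcond /=; apply: eq_bigr => mu _.
rewrite mulrCA -polyCM coefXnM coefC subn_eq0 (fun_if (fun p : {poly S} => p`_r)).
rewrite (fun_if (fun p : {poly S} => p`_r)) coef0 coefCM coefXn.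
by rewrite [r == _]eq_sym; case: ltngtP; case: eqP; rewrite ?mulr1 ?mulr0.
Qed.

End DetExpand.

(** Expansion along column 0, where only [z] at the top and [c 0] at the bottom survive. The minor
    of [z] is a companion matrix for the shifted [a] and [c]; the minor of [c 0] is lower triangular
    with the [a i], [i > 0], on its diagonal. *)
Lemma det_companion_succ (R : comNzRingType) (z : R) (n : nat) (a c : nat -> R) :
  \det (\matrix_(i < n.+1, j < n.+1)
     (z *+ (i == j) + a j *+ (j == i.+1 :> nat) + c j *+ (i == n :> nat)))
  = z ^+ n.+1 + \sum_(j < n.+1) (-1) ^+ (n - j) * c j * z ^+ j *
      \prod_(j.+1 <= i < n.+1) a i.
Proof.
elim: n a c => [|n IHn] a c.
  by rewrite det_mx11 !mxE /= big_ord1 big_geq // !mulr1 mul1r addr0.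
rewrite (expand_det_col _ 0) big_ord_recl big_ord_recr /= big1 ?add0r; last first.
  move=> i _; rewrite !mxE /= (_ : (bump 0 i == n.+1) = false).
    by rewrite !mulr0n !addr0 mul0r.
  by rewrite /bump add1n eqSS ltn_eqF.
rewrite !mxE /= !addr0 [z *+ true]mulr1n [z *+ false]mulr0n add0r.
have -> : cofactor (\matrix_(i < n.+2, j < n.+2)
     (z *+ (i == j) + a j *+ (j == i.+1 :> nat) + c j *+ (i == n.+1 :> nat))) 0 0 =
   \det (\matrix_(i < n.+1, j < n.+1) (z *+ (i == j) + a j.+1 *+ (j == i.+1 :> nat)
       + c j.+1 *+ (i == n :> nat))).
  rewrite /cofactor addn0 expr0 mul1r; congr (\det _).
  by apply/matrixP=> i j; rewrite !mxE (inj_eq lift_inj) /= /bump !leq0n.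
rewrite (IHn (fun i => a i.+1) (fun i => c i.+1)) mulrDr -exprS -addrA; congr (_ + _).
rewrite [in RHS]big_ord_recl addrC; congr (_ + _).
  rewrite /= /cofactor /= /bump leq0n !add1n eqxx mulr1n.
  rewrite subn0 expr0 mulr1 addn0 mulrCA mulrA; congr (_ * _).
  set B := row' _ _.
  have BE i j : B i j = z *+ (i == j.+1 :> nat) + a j.+1 *+ (j == i :> nat).
    have iE : bump (bump 0 n) i = i by rewrite /bump add1n leqNgt ltn_ord.
    rewrite !mxE -val_eqE /= iE /bump add1n eqSS (ltn_eqF (ltn_ord i)).
    by rewrite addr0.
  rewrite det_trig; last first.
    apply/is_trig_mxP=> i j lt_ij; rewrite BE (gtn_eqF lt_ij).
    by rewrite (ltn_eqF (leqW lt_ij)) addr0.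
  rewrite big_add1 big_mkord; apply: eq_bigr => i _.
  by rewrite BE eqxx (ltn_eqF (ltnSn i)) add0r.
rewrite mulr_sumr; apply: eq_bigr => j _.
rewrite /= /bump leq0n add1n subSS [in RHS]big_add1 /= mulrA exprS; congr (_ * _).
by rewrite mulrCA !mulrA.
Qed.

Lemma det_companion (R : comNzRingType) (z : R) (n : nat) (a c : nat -> R) :
  (0 < n)%N ->
  \det (\matrix_(i < n, j < n)
     (z *+ (i == j) + a j *+ (j == i.+1 :> nat) + c j *+ (i.+1 == n)))
  = z ^+ n + \sum_(j < n) (-1) ^+ (n.-1 - j) * c j * z ^+ j *
      \prod_(j.+1 <= i < n) a i.
Proof. by case: n => // n _; apply: det_companion_succ. Qed.

(** * Derivations *)

Definition derivation (R : nzRingType) (D : R -> R) :=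
  {morph D : x y / x + y} /\ forall x y, D (x * y) = D x * y + x * D y.

Section Derivation.
Variables (R : comNzRingType) (D : R -> R).
Hypothesis dD : derivation D.

Lemma derivation0 : D 0 = 0.
Proof. by apply: (addrI (D 0)); rewrite -dD.1 !addr0. Qed.

Lemma derivation1 : D 1 = 0.
Proof. by apply: (addrI (D 1)); rewrite addr0 -{3}[1]mulr1 dD.2 mulr1 mul1r. Qed.

Lemma derivationN x : D (- x) = - D x.
Proof. by apply: (addrI (D x)); rewrite -dD.1 !subrr derivation0. Qed.

Lemma derivationMn x k : D (x *+ k) = D x *+ k.
Proof. by elim: k => [|k IHk]; rewrite ?derivation0 // !mulrS dD.1 IHk. Qed.

Lemma derivation_sum (I : Type) (r : seq I) (P : pred I) (f : I -> R) :
  D (\sum_(i <- r | P i) f i) = \sum_(i <- r | P i) D (f i).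
Proof. exact: (big_morph D dD.1 derivation0). Qed.

Lemma derivation_sign (b : bool) x : D ((-1) ^+ b * x) = (-1) ^+ b * D x.
Proof. by rewrite !mulr_sign; case: b; rewrite ?derivationN. Qed.

Lemma derivation_prod (I : finType) (f : I -> R) :
  D (\prod_i f i) = \sum_i D (f i) * \prod_(j | j != i) f j.
Proof.
suff H (s : seq I) : uniq s -> D (\prod_(i <- s) f i) =
    \sum_(i <- s) D (f i) * \prod_(j <- s | j != i) f j.
  by rewrite H ?index_enum_uniq.
elim: s => [|x s IHs] /=; first by rewrite !big_nil derivation1.
case/andP=> xs us; rewrite !big_cons dD.2 eqxx /= IHs //; congr (_ + _).
  rewrite big_seq_cond [in RHS]big_seq_cond [in RHS]big_mkcondr.
  congr (_ * _); apply: eq_big => [i|i]; first by rewrite andbT.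
  by move=> /andP[is_ _]; case: eqP is_ xs => // -> ->.
rewrite mulr_sumr; apply: eq_big_seq => i is_; rewrite big_cons.
have -> : x != i by apply: contraNneq xs => ->.
by rewrite mulrCA.
Qed.

(** Jacobi's formula: differentiate one row at a time and expand along that row. *)
Lemma derivation_det n (M : 'M[R]_n) :
  D (\det M) = \sum_i \sum_j D (M i j) * cofactor M i j.
Proof.
pose row_D i := \matrix_(k, j) (if k == i then D (M k j) else M k j).
transitivity (\sum_i \det (row_D i)).
  rewrite derivation_sum exchange_big /=; apply: eq_bigr => s _.
  rewrite derivation_sign derivation_prod mulr_sumr; apply: eq_bigr => i _.
  congr (_ * _); rewrite [RHS](bigD1 i) //= !mxE eqxx; congr (_ * _).
  by apply: eq_bigr => k /negPf ki; rewrite !mxE ki.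
apply: eq_bigr => i _; rewrite (expand_det_row _ i); apply: eq_bigr => j _.
rewrite !mxE eqxx; congr (_ * (_ * \det _)).
by apply/matrixP=> k l; rewrite !mxE eq_sym (negPf (neq_lift _ _)).
Qed.

(** Up to the factor [u], [D] is a row operation minus a column operation on [P]. By Jacobi's
    formula and the adjugate identities each operation contributes [\det M] if [a = b] and 0
    otherwise, less [z] times the cofactor at [(b, a)], so the two cancel. The corrections [v] and
    [w] survive as determinants with a row or a column replaced. *)
Lemma derivation_det_replace n (M Mrow Mcol : 'M[R]_n) (u z : R) (a b : 'I_n)
    (P : 'I_n -> 'I_n -> R) (v w : 'I_n -> R) :
  (forall k l, k != b -> Mrow k l = M k l) -> (forall l, Mrow b l = v l) ->
  (forall k l, l != a -> Mcol k l = M k l) -> (forall k, Mcol k a = w k) ->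
  (forall k l, M k l = P k l + z *+ (k == l)) ->
  (forall i j, u * D (M i j) =
     (P a j - v j) *+ (i == b) - (P i b - w i) *+ (j == a)) ->
  u * D (\det M) = \det Mcol - \det Mrow.
Proof.
move=> rowE vE colE wE ME DP.
have {DP} DM i j : u * D (M i j) =
     (M a j - z *+ (a == j) - Mrow b j) *+ (i == b)
     - (M i b - z *+ (i == b) - Mcol i a) *+ (j == a).
  by rewrite DP !(ME a) !(ME i b) !addrK vE wE.
have row_det : \det Mrow = \sum_j Mrow b j * cofactor M b j.
  rewrite (expand_det_row _ b); apply: eq_bigr => j _; congr (_ * _).
  by apply: eq_cofactor => k l kb _; apply: rowE.
have col_det : \det Mcol = \sum_i Mcol i a * cofactor M i a.
  rewrite (expand_det_col _ a); apply: eq_bigr => i _; congr (_ * _).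
  by apply: eq_cofactor => k l _ la; apply: colE.
have row_M : \sum_j M a j * cofactor M b j = \det M *+ (a == b).
  have /matrixP/(_ a b) := mul_mx_adj M; rewrite !mxE => <-.
  by apply: eq_bigr => j _; rewrite !mxE.
have col_M : \sum_i M i b * cofactor M i a = \det M *+ (a == b).
  have /matrixP/(_ a b) := mul_adj_mx M; rewrite !mxE => <-.
  by apply: eq_bigr => j _; rewrite !mxE mulrC.
have single k (f : 'I_n -> R) : \sum_i f i *+ (i == k) = f k.
  by rewrite (bigD1 k) //= eqxx big1 ?addr0 // => i /negPf->.
rewrite derivation_det mulr_sumr.
transitivity (\sum_j (M a j - z *+ (a == j) - Mrow b j) * cofactor M b j
  - \sum_i (M i b - z *+ (i == b) - Mcol i a) * cofactor M i a).
  rewrite -[X in X - _](single b (fun i =>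
    \sum_j (M a j - z *+ (a == j) - Mrow b j) * cofactor M i j)) -sumrB.
  apply: eq_bigr => i _.
  rewrite -[X in _ - X](single a (fun j =>
    (M i b - z *+ (i == b) - Mcol i a) * cofactor M i j)) -sumrMnl -sumrB mulr_sumr.
  by apply: eq_bigr => j _; rewrite mulrA DM mulrBl !mulrnAl.
under eq_bigr do rewrite !mulrBl; under [X in _ - X]eq_bigr do rewrite !mulrBl.
rewrite !sumrB row_M col_M -row_det -col_det.
have -> : \sum_j z *+ (a == j) * cofactor M b j = z * cofactor M b a.
  by rewrite -(single a (fun j => z * cofactor M b j)); apply: eq_bigr => j _;
    rewrite eq_sym mulrnAl.
have -> : \sum_i z *+ (i == b) * cofactor M i a = z * cofactor M b a.
  by rewrite -(single b (fun i => z * cofactor M i a)); apply: eq_bigr => i _;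
    rewrite mulrnAl.
by rewrite opprB [LHS]addrC addrA subrK.
Qed.

Lemma derivation_map_poly : derivation (map_poly D).
Proof.
have mapE p k : (map_poly D p)`_k = D p`_k by rewrite coef_map_id0 ?derivation0.
split=> [p q|p q]; apply/polyP=> k; rewrite ?coefD ?mapE ?coefD ?dD.1 //.
rewrite !coefM derivation_sum -big_split /=.
by apply: eq_bigr => i _; rewrite dD.2 !mapE.
Qed.

Lemma map_derivationC c : map_poly D c%:P = (D c)%:P.
Proof.
apply/polyP=> k; rewrite coef_map_id0 ?derivation0 // !coefC.
by case: ifP; rewrite ?derivation0.
Qed.

Lemma map_derivationX : map_poly D 'X = 0.
Proof.
apply/polyP=> k; rewrite coef_map_id0 ?derivation0 // coefX coef0.
by case: (k == 1%N); rewrite ?derivation0 ?derivation1.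
Qed.

End Derivation.

(** * Lowest coefficients; morphisms and derivations on multivariate polynomials *)

Lemma coefM_low (R : nzRingType) (p q : {poly R}) k :
  (forall m, (m < k)%N -> p`_m = 0) -> (p * q)`_k = p`_k * q`_0.
Proof.
move=> p_low; rewrite coefM big_ord_recr /= big1 ?add0r ?subnn // => i _.
by rewrite p_low ?mul0r.
Qed.

Lemma mpoly_ring_ind (R : nzRingType) (n : nat) (P : {mpoly R[n]} -> Prop) :
  (forall c, P c%:MP) -> (forall i, P 'X_i) ->
  (forall p q, P p -> P q -> P (p + q)) ->
  (forall p q, P p -> P q -> P (p * q)) -> forall p, P p.
Proof.
move=> PC PX PD PM; have PXm m : P 'X_[m].
  rewrite mpolyXE_id; apply: (big_ind P) => [|//|i _]; first by rewrite -mpolyC1.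
  by elim: (m i) => [|k IHk]; rewrite ?expr0 -?mpolyC1 // exprS; apply: PM.
elim/mpolyind => [|c m p _ _ Pp]; first by rewrite -mpolyC0.
by apply: PD => //; rewrite -mul_mpolyC; apply: PM.
Qed.

Lemma eq_mpoly_rmorphism (R : nzRingType) (n : nat) (B : nzRingType)
    (f g : {rmorphism {mpoly R[n]} -> B}) :
  (forall c, f c%:MP = g c%:MP) -> (forall i, f 'X_i = g 'X_i) -> f =1 g.
Proof.
move=> eqC eqX; elim/mpoly_ring_ind => [//|//|p q IHp IHq|p q IHp IHq].
  by rewrite !rmorphD IHp IHq.
by rewrite !rmorphM IHp IHq.
Qed.

(** Chain rule. It serves [adS b] on polynomials in the x_r, and both the partial derivatives and
    the formal derivative of [scaled]. *)
Lemma derivation_mmap (R : nzRingType) (n : nat) (B : comNzRingType)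
    (f : {rmorphism R -> B}) (h : 'I_n -> B) (D : B -> B) :
  derivation D -> (forall c, D (f c) = 0) ->
  forall p, D (mmap f h p) = \sum_i mmap f h p^`M(i) * D (h i).
Proof.
move=> dD Df; elim/mpoly_ring_ind => [c|i|p q IHp IHq|p q IHp IHq].
- by rewrite mmapC Df big1 // => i _; rewrite mderivC mmap0 mul0r.
- rewrite mmapX mmap1U (bigD1 i) //= big1 => [|j ji].
    by rewrite mderivX mnm1E eqxx -{1}[U_(i)%MM]add0m addmK scale1r mmapX mmap11 mul1r addr0.
  by rewrite mderivX mnm1E eq_sym (negPf ji) scale0r mmap0 mul0r.
- rewrite mmapD dD.1 IHp IHq -big_split; apply: eq_bigr => i _.
  by rewrite mderivD mmapD mulrDl.
rewrite rmorphM dD.2 IHp IHq mulr_suml mulr_sumr -big_split; apply: eq_bigr => i _.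
by rewrite mderivM rmorphD !rmorphM /= mulrDl mulrA [in RHS]mulrAC.
Qed.

(** * The diagram and the basis of the centralizer *)

Section Diagram.
Variable lam : seq nat.
Local Notation n := (nrows lam).
Local Notation N := (Nsz lam).
Local Notation lm := (lm lam).
Local Notation pre := (pre lam).
Local Notation row := (Defs.row lam).
Local Notation col := (Defs.col lam).
Local Notation sij := (sij lam).

Lemma lm_gt0_lt i : (0 < lm i)%N -> (i < n)%N.
Proof. by case: (ltnP i n) => // ni; rewrite /lm nth_default. Qed.

Lemma pre_succ i : pre i.+1 = (pre i + lm i)%N.
Proof.
have [ni|ni] := leqP (size lam) i.
  by rewrite /pre /lm !take_oversize ?nth_default ?addn0 // leqW.
by rewrite /pre (take_nth 0%N) // -cats1 sumn_cat /= addn0.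
Qed.

Lemma leq_pre i j : (i <= j)%N -> (pre i <= pre j)%N.
Proof.
elim: j => [|j IHj]; first by rewrite leqn0 => /eqP->.
rewrite leq_eqVlt ltnS => /predU1P[-> //|/IHj ij].
by rewrite pre_succ (leq_trans ij) // leq_addr.
Qed.

Lemma pre_leN i : (pre i <= N)%N.
Proof. by rewrite /pre /Nsz -{2}[lam](cat_take_drop i) sumn_cat leq_addr. Qed.

Lemma lm_leN i : (lm i <= N)%N.
Proof. by rewrite (leq_trans _ (pre_leN i.+1)) // pre_succ leq_addl. Qed.

Lemma box_ltN i c : (c < lm i)%N -> (pre i + c < N)%N.
Proof. by move=> ci; rewrite (leq_trans _ (pre_leN i.+1)) // pre_succ ltn_add2l. Qed.

Lemma box_exists h : (h < N)%N -> exists i c, (c < lm i)%N /\ h = (pre i + c)%N.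
Proof.
have -> : N = pre n by rewrite /pre take_size.
elim: n => [|m IHm]; first by rewrite /pre take0.
have [/IHm //|mh] := ltnP h (pre m); rewrite pre_succ => hm.
by exists m, (h - pre m)%N; rewrite ltn_subLR // subnKC.
Qed.

Lemma row_box i c : (c < lm i)%N -> row (pre i + c) = i.
Proof.
move=> ci; have ltin : (i < n)%N by apply: lm_gt0_lt; apply: leq_ltn_trans ci.
rewrite /Defs.row (@eq_count _ _ (fun k => k < i)%N); last first.
  move=> k /=; have [ki|ik] := ltnP k i.
    by rewrite (leq_trans (leq_pre ki)) // leq_addr.
  apply/negbTE; rewrite -ltnNge (leq_trans _ (leq_pre (_ : i.+1 <= k.+1)%N)) //.
  by rewrite pre_succ ltn_add2l.
rewrite -size_filter (eq_filter (a2 := fun k => k < 0 + i)%N) ?filter_iota_ltn ?size_iota //.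
exact: ltnW.
Qed.

Lemma col_box i c : (c < lm i)%N -> col (pre i + c) = c.
Proof. by move=> ci; rewrite /Defs.col row_box // addKn. Qed.

Variable F : fieldType.
Local Notation Emat := (Emat F lam).
Local Notation Bidx := (Bidx lam).
Local Notation bi := (@bi lam).
Local Notation bj := (@bj lam).
Local Notation br := (@br lam).
Local Notation Sge := (Sge F lam).
Local Notation Xe := (Xe F lam).
Local Notation adS := (@adS F lam).

(** The bound says [sij h k <= s]. It guarantees that the middle box, in row [h] and column
    [col x + r], exists whenever the end box does, so no matrix unit of the product is lost. *)
Lemma Emat_mul i j r h k s : (lm k <= s + lm h)%N ->
  Emat i j r *m Emat h k s = if j == h then Emat i k (r + s) else 0.
Proof.
move=> le_kh; apply/matrixP=> x y; rewrite !mxE.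
have [jh|jh] := eqVneq j h; last first.
  rewrite mxE big1 // => z _; rewrite !mxE.
  have [->|] := eqVneq (row z) j; last by rewrite andbF mul0r.
  by rewrite (negPf jh) mulr0.
rewrite -jh in le_kh *; rewrite mxE.
have [c [d [dc yE]]] := box_exists (ltn_ord y); rewrite yE (row_box dc) (col_box dc).
have [ck|ck] := eqVneq c k; last first.
  by rewrite andbF big1 // => z _; rewrite !mxE yE (row_box dc) (negPf ck) andbF mulr0.
rewrite {c}ck in dc yE *.
have [rx|rx] := eqVneq (row x) i; last first.
  by rewrite big1 // => z _; rewrite !mxE (negPf rx) mul0r.
have [dE|dE] := eqVneq d (col x + (r + s))%N; last first.
  rewrite big1 // => z _; rewrite !mxE yE (row_box dc) (col_box dc).
  case: (row z == j); last by rewrite andbF mul0r.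
  rewrite rx !eqxx /=; case: eqP => [->|]; last by rewrite mul0r.
  by rewrite -addnA (negPf dE) mulr0.
have zc : (col x + r < lm j)%N by lia.
have zN := box_ltN zc.
rewrite (bigD1 (Ordinal zN)) //= big1 ?addr0.
  by rewrite !mxE yE /= !row_box ?col_box // rx dE addnA !eqxx mulr1.
move=> z; rewrite -val_eqE /= => zne; rewrite !mxE.
have [e [f [fe zE]]] := box_exists (ltn_ord z); move: zne.
rewrite zE row_box // col_box //; have [->|] := eqVneq e j; last by rewrite andbF mul0r.
by rewrite eqn_add2l => /negPf->; rewrite andbF mul0r.
Qed.

Lemma bi_lt (b : Bidx) : (bi b < n)%N. Proof. exact: ltn_ord. Qed.
Lemma bj_lt (b : Bidx) : (bj b < n)%N. Proof. exact: ltn_ord. Qed.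
Lemma br_bounds (b : Bidx) : (sij (bi b) (bj b) <= br b < lm (bj b))%N.
Proof. exact: (valP b). Qed.

Lemma Bidx_inj (b c : Bidx) : bi b = bi c -> bj b = bj c -> br b = br c -> b = c.
Proof.
by case: b c => [[[i j] r] ?] [[[i' j'] r'] ?]; rewrite /bi /bj /br /= => ? ? ?;
  apply/val_inj => /=; congr (_, _, _); apply: val_inj.
Qed.

Lemma Bidx_exists i j r : (i < n)%N -> (j < n)%N -> (sij i j <= r < lm j)%N ->
  exists b : Bidx, [/\ bi b = i, bj b = j & br b = r].
Proof.
move=> i_n j_n rb; have rN : (r < N)%N.
  by case/andP: rb => _ rj; apply: leq_trans (lm_leN j).
pose t := (Ordinal i_n, Ordinal j_n, Ordinal rN).
by exists (Sub t rb : Bidx).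
Qed.

Lemma coord_Emat (b : Bidx) i j r :
  Defs.coord b (Emat i j r) = ((bi b == i) && (bj b == j) && (br b == r))%:R.
Proof.
have /andP[sb rb] := br_bounds b; rewrite /sij in sb.
have hc : (lm (bj b) - 1 - br b < lm (bi b))%N by lia.
have kc : (lm (bj b) - 1 < lm (bj b))%N by lia.
have kN : (kbox b < N)%N by rewrite /kbox -addnBA ?box_ltN //; lia.
rewrite /Defs.coord (bigD1 (Ordinal (box_ltN hc))) //= [X in _ + X]big1 ?addr0.
  rewrite (bigD1 (Ordinal kN)) //= [X in _ + X]big1 ?addr0.
    rewrite !eqxx mxE /= row_box // col_box // /kbox -addnBA ?row_box ?col_box //; last lia.
    congr (_ && _)%:R; lia.
  by move=> k; rewrite -val_eqE /= => /negPf->; rewrite andbF.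
move=> h; rewrite -val_eqE /= => /negPf hE; rewrite big1 // => k _.
by rewrite /hbox hE.
Qed.

Lemma lin_Emat i j r : lin (Emat i j r) = Xe i j r.
Proof.
rewrite /lin /Xe [RHS]big_mkcond /=; apply: eq_bigr => b _.
by rewrite coord_Emat; case: ifP => _; rewrite ?scale1r ?scale0r.
Qed.

Lemma coordB (b : Bidx) (A B : 'M[F]_N) : Defs.coord b (A - B)
  = Defs.coord b A - Defs.coord b B.
Proof.
rewrite /Defs.coord -sumrB; apply: eq_bigr => h _; rewrite -sumrB; apply: eq_bigr => k _.
by rewrite !mxE; case: ifP; rewrite ?subrr.
Qed.

Lemma linB (A B : 'M[F]_N) : lin (A - B) = lin A - lin B.
Proof.
by rewrite /lin -sumrB; apply: eq_bigr => b _; rewrite coordB scalerBl.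
Qed.

Lemma lin0 : lin (0 : 'M[F]_N) = 0.
Proof. by rewrite -(subrr 0) linB subrr. Qed.

Lemma lin_bracket (b c : Bidx) :
  lin (Eb F b *m Eb F c - Eb F c *m Eb F b) =
  Xe (bi b) (bj c) (br b + br c) *+ (bj b == bi c)
  - Xe (bi c) (bj b) (br b + br c) *+ (bj c == bi b).
Proof.
have /andP[sb rb] := br_bounds b; have /andP[sc rc] := br_bounds c.
rewrite /sij in sb sc.
rewrite linB /Eb !Emat_mul; [|lia|lia].
by rewrite !(fun_if (@lin F lam)) !lin_Emat lin0 [(br c + br b)%N]addnC
  !mulrb.
Qed.

Lemma Xe_Xb (b : Bidx) : Xe (bi b) (bj b) (br b) = Xb F b.
Proof.
rewrite /Xe (bigD1 b) ?eqxx //= big1 ?addr0 // => c /andP[/andP[/andP[/eqP ? /eqP ?] /eqP ?]].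
by rewrite (Bidx_inj (b := c) (c := b)) ?eqxx.
Qed.

Lemma Xe_eq0 i j r : ~~ (sij i j <= r < lm j)%N -> Xe i j r = 0.
Proof.
move=> nr; rewrite /Xe big_pred0 // => b; apply/negbTE; apply: contra nr.
by move=> /andP[/andP[/eqP<- /eqP<-] /eqP<-]; apply: br_bounds.
Qed.

Lemma adS_derivation (b : Bidx) : derivation (adS b).
Proof.
split=> [f g|f g]; rewrite /adS ?mulr_suml ?mulr_sumr -big_split /=; apply: eq_bigr => c _.
  by rewrite mderivD mulrDl.
by rewrite mderivM mulrDl mulrA [in LHS]mulrAC.
Qed.

Lemma adSC (b : Bidx) c : adS b c%:MP = 0.
Proof. by rewrite /adS big1 // => d _; rewrite mderivC mul0r. Qed.

Lemma adS_Xb (b c : Bidx) :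
  adS b (Xb F c) = lin (Eb F b *m Eb F c - Eb F c *m Eb F b).
Proof.
rewrite /adS (bigD1 c) //= big1 ?addr0 => [|d dc].
  by rewrite mderivX mnm1E eqxx -{1}[U_(_)%MM]add0m addmK mpolyX0 scale1r mul1r.
by rewrite mderivX mnm1E (inj_eq enum_rank_inj) eq_sym (negPf dc) scale0r mul0r.
Qed.

(** The bracket formula persists for [r >= lm j], where all terms vanish. Below [sij i j] it may
    fail: the left side is zero but the right side need not be, and this is the source of the
    truncation terms. *)
Lemma adS_Xe (b : Bidx) i j r : (i < n)%N -> (j < n)%N -> (sij i j <= r)%N ->
  adS b (Xe i j r) =
  Xe (bi b) j (br b + r) *+ (bj b == i) - Xe i (bj b) (br b + r) *+ (j == bi b).
Proof.
move=> i_n j_n sr; have [rj|jr] := ltnP r (lm j).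
  have [|c [<- <- <-]] := Bidx_exists i_n j_n (r := r); first by rewrite sr.
  by rewrite Xe_Xb adS_Xb lin_bracket.
have /andP[sb rb] := br_bounds b; rewrite /sij in sb.
have Xe0 i' j' r' : (lm j' <= r')%N -> Xe i' j' r' = 0.
  by move=> jr'; apply: Xe_eq0; rewrite negb_and -leqNgt jr' orbT.
rewrite Xe0 // (derivation0 (adS_derivation b)) (Xe0 _ j) ?mul0rn; last lia.
have [jb|] := eqVneq j (bi b); last by rewrite mulr0n subr0.
by rewrite jb in jr; rewrite (Xe0 i) ?mul0rn ?subr0 //; lia.
Qed.

End Diagram.

(** * Sums of row lengths *)

Lemma nth_flatten_nseq (f : nat -> nat) m q x :
  (x < \sum_(m <= k < m + q) f k)%N ->
  let d := nth 0%N (flatten [seq nseq (f k) k | k <- iota m q]) x in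
  [/\ (m <= d < m + q)%N, (\sum_(m <= k < d) f k <= x)%N
    & (x < \sum_(m <= k < d.+1) f k)%N].
Proof.
elim: q m x => [|q IHq] m x /=; first by rewrite addn0 big_geq.
rewrite big_ltn ?addnS ?ltnS ?leq_addr // nth_cat size_nseq -addSn.
have [xf _|fx lt_x] := ltnP x (f m).
  by rewrite nth_nseq xf leqnn leq_addr big_geq // big_nat1.
have [|] := IHq m.+1 (x - f m)%N; first by rewrite ltn_subLR.
set d := nth _ _ _ => /andP[md dq] le_x x_lt; split.
- lia.
- by rewrite big_ltn // -leq_subRL.
by rewrite big_ltn ?(leqW md) // -ltn_subLR.
Qed.

Section Sizes.
Variable lam : seq nat.
Hypothesis lam_sorted : sorted leq lam.
Local Notation n := (nrows lam).
Local Notation N := (Nsz lam).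
Local Notation lm := (lm lam).

(** The number of boxes in the last [d - 1] rows, which are the longest ones when [lam] is sorted;
    d_r is the [d] with [tail d < r <= tail d.+1]. *)
Definition tail (d : nat) : nat := \sum_(1 <= k < d) lm (n - k).

Lemma tail_total : tail n.+1 = N.
Proof.
rewrite /tail /Nsz sumnE [RHS](big_nth 0%N) big_add1 /= big_nat_rev /=.
by apply: eq_big_nat => i /andP[_ i_n]; rewrite add0n subnSK // subKn // ltnW.
Qed.

Lemma dr_bounds r : (0 < r <= N)%N ->
  [/\ (0 < dr lam r <= n)%N, (tail (dr lam r) < r)%N & (r <= tail (dr lam r).+1)%N].
Proof.
case: r => // r /= r_N.
have := @nth_flatten_nseq (fun k => lm (n - k)) 1 n r.
rewrite add1n -[X in (r < X)%N]/(tail n.+1) tail_total => /(_ r_N).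
by rewrite -/(dseq lam) -[nth _ _ _]/(dr lam r.+1) ltnS => -[].
Qed.

Lemma leq_lm i j : (i <= j < n)%N -> (lm i <= lm j)%N.
Proof.
case/andP=> ij jn; have := sorted_leq_nth leq_trans leqnn 0%N lam_sorted.
by apply => //; rewrite inE // (leq_ltn_trans ij).
Qed.

(** Induction on the number of rows considered: a new row that is selected becomes the longest term
    on the right, and one that is not selected only replaces each term by that of a longer row. *)
Lemma sum_pred_le_tail (P : pred nat) q : (q <= n)%N ->
  (\sum_(0 <= i < q) P i * lm i <=
   \sum_(1 <= k < (\sum_(0 <= i < q) P i).+1) lm (q - k))%N.
Proof.
elim: q => [|q IHq] q_n; first by rewrite big_geq.
have {IHq} := IHq (ltnW q_n).
rewrite !(big_nat_recr q) //=.
case: (P q) => IHq; last first.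
  rewrite mul0n addn0 addn0; apply: leq_trans IHq _.
  rewrite big_nat [leqRHS]big_nat; apply: leq_sum => k /andP[k_gt0 _].
  by apply: leq_lm; lia.
rewrite mul1n addn1 big_add1 /= big_nat_recl //= subn1 /= addnC leq_add2l.
by apply: leq_trans IHq _; rewrite big_add1.
Qed.

Lemma sum_set_le_tail (K : {set 'I_n}) : (\sum_(i in K) lm i <= tail #|K|.+1)%N.
Proof.
pose P k := oapp (mem K) false (insub k).
have PE (i : 'I_n) : P i = (i \in K) by rewrite /P valK.
have := sum_pred_le_tail P (leqnn n); rewrite !big_mkord.
rewrite (eq_bigr (fun i : 'I_n => (i \in K) * lm i)%N); last by move=> i _; rewrite PE.
rewrite [X in (_ <= \sum_(1 <= k < X.+1) _)%N](_ : _ = #|K|); last first.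
  by rewrite -sum1_card [RHS]big_mkcond /=; apply: eq_bigr => i _; rewrite PE; case: ifP.
apply: leq_trans; rewrite big_mkcond /=; apply: leq_sum => i _.
by case: ifP; rewrite ?mul1n.
Qed.

(** Bound every part except [mu y] by its row length. If row [y] is longer than row [x], adding
    [sij lam x y] trades row [x] for row [y], leaving the support without [x]; otherwise
    [sij lam x y = 0] and the support without [y] is left. Either way one row fewer than the support
    remains. *)
Lemma sum_mu_le (mu : 'I_n -> nat) (x y : 'I_n) s :
  mu x != 0%N -> mu y != 0%N -> (mu y <= s + sij lam x y)%N ->
  (forall j, j != y -> mu j <= lm j)%N ->
  (\sum_j mu j <= s + tail #|[set j | mu j != 0%N]|)%N.
Proof.
move=> mux muy le_y le_mu; set I := [set j | mu j != 0%N].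
have xI : x \in I by rewrite inE.
have yI : y \in I by rewrite inE.
have cardI z : z \in I -> #|I| = #|I :\ z|.+1 by move=> zI; rewrite (cardsD1 z) zI.
have tailI z : z \in I -> (\sum_(i in I :\ z) lm i <= tail #|I|)%N.
  by move=> /cardI->; apply: sum_set_le_tail.
have split_sum z (f : 'I_n -> nat) : z \in I ->
    (\sum_(i in I) f i = f z + \sum_(i in I :\ z) f i)%N.
  by move=> zI; rewrite (bigD1 z) //=; congr (_ + _)%N;
    apply: eq_bigl => i; rewrite !inE andbC.
have -> : (\sum_j mu j = \sum_(j in I) mu j)%N.
  by rewrite [RHS]big_mkcond /=; apply: eq_bigr => i _; rewrite inE; case: eqP.
have le_sum : (\sum_(j in I :\ y) mu j <= \sum_(j in I :\ y) lm j)%N.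
  by apply: leq_sum => j; rewrite !inE => /andP[jy _]; apply: le_mu.
rewrite (split_sum y) //; move: (split_sum x (fun i => lm i) xI).
rewrite (split_sum y) // => eq_xy; have := tailI x xI; have := tailI y yI.
by rewrite /sij in le_y; lia.
Qed.

End Sizes.

(** * Invariance *)

Section Invariance.
Variables (F : fieldType) (lam : seq nat).
Hypothesis lam_sorted : sorted leq lam.
Local Notation n := (nrows lam).
Local Notation N := (Nsz lam).
Local Notation lm := (lm lam).
Local Notation sij := (sij lam).
Local Notation S := (Sge F lam).
Local Notation Xe := (Xe F lam).

Lemma Xe_ge i j r : (lm j <= r)%N -> Xe i j r = 0.
Proof. by move=> jr; rewrite Xe_eq0 // negb_and -leqNgt jr orbT. Qed.

Lemma Xe_lt i j r : (r < sij i j)%N -> Xe i j r = 0.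
Proof. by move=> jr; rewrite Xe_eq0 // negb_and -ltnNge jr. Qed.

Definition gen_entry (i j : 'I_n) (t : nat) : S :=
  if t == 0%N then (i == j)%:R else Xe i j t.-1.

Lemma det_gen_entry (mu : Mu lam) d : mlen mu = d ->
  \sum_(w : 'S_d) (-1) ^+ w * \prod_(k < d)
        Xe (nth 0%N (mpos mu) (w k)) (nth 0%N (mpos mu) k)
           (mun mu (nth 0%N (mpos mu) k) - 1)
  = \det (\matrix_(i, j) gen_entry i j (mu j)).
Proof.
move=> <-; rewrite /mlen; set A := [set i | _].
have mposE (k : 'I_#|A|) : nth 0%N (mpos mu) k = enum_val k.
  have kA : (k < size (enum A))%N by rewrite -cardE.
  have -> : mpos mu = map val (enum A).
    by rewrite /mpos; congr map; rewrite enumT /enum_mem; apply: eq_filter => i; rewrite !inE.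
  by rewrite (nth_map (enum_val k)) // -enum_val_nth.
rewrite (det_unit_cols (p := @enum_val _ (mem A))); last 2 first.
- exact: enum_val_inj.
- move=> i j jA; rewrite mxE /gen_entry; case: eqP => // muj.
  case/negP: jA; have jA : j \in A by rewrite inE; apply/eqP.
  by rewrite -(enum_rankK_in jA jA) codom_f.
(* In x_r the permutation acts on the row index, hence the transpose. *)
rewrite -det_tr; apply: eq_bigr => w _; congr (_ * _); apply: eq_bigr => k _.
rewrite !mxE !mposE /gen_entry.
have /negPf -> : mu (enum_val k) != 0%N :> nat by have := enum_valP k; rewrite inE.
by rewrite /mun (big_pred1 (enum_val k)) ?subn1.
Qed.

Lemma card_zeros (mu : 'I_n -> nat) d : (d <= n)%N ->
  (#|[set j | mu j == 0%N]| == n - d)%N = (#|[set j | mu j != 0%N]| == d).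
Proof.
move=> dn; have := cardsC [set j | mu j == 0%N]; rewrite card_ord.
rewrite (_ : ~: _ = [set j | mu j != 0%N]); last by apply/setP=> j; rewrite !inE.
lia.
Qed.

(** The coefficient runs over all [mu] with parts up to [N]; those not contained in [lam] drop out
    because a part [mu j > lm j] selects a zero column. *)
Lemma xr_coef r : (dr lam r <= n)%N ->
  xr F lam r = ((\det (zu_mx N gen_entry))`_(n - dr lam r))`_r.
Proof.
move=> dn; rewrite det_zu_mx /xr big_mkcond [RHS]big_mkcond /=.
apply: eq_bigr => mu _; rewrite (card_zeros _ dn) [in RHS]andbC.
rewrite -/(Defs.msize mu) -/(mlen mu).
case: (Defs.msize mu == r); rewrite ?andbF //=; case: eqP => [len|_]; rewrite ?andbF //= andbT.
rewrite (det_gen_entry len); case: ifPn => //.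
rewrite negb_forall => /existsP[j]; rewrite -ltnNge => lt_j.
rewrite (expand_det_col _ j) big1 // => i _.
by rewrite mxE /gen_entry gtn_eqF ?Xe_ge ?mul0r //; lia.
Qed.

(** * Action of one basis element on the determinant *)

Section Action.
Variable b : Bidx lam.
Let a := (val b).1.1.
Let b' := (val b).1.2.
Let s := br b.
Local Notation D := (@adS F lam b).
Let dD : derivation D := adS_derivation F b.

(* adS b raises the last index by s, so it misses the terms of the entries (a, j)
   and (i, b') listed below; row b', resp. column a, is replaced by them. *)
Let row_trunc (i j : 'I_n) (t : nat) : S :=
  if i == b' then (if (0 < t <= s + sij i j)%N then Xe a j t.-1 else 0) else gen_entry i j t.
Let col_trunc (i j : 'I_n) (t : nat) : S :=
  if j == a then (if (0 < t <= s + sij i j)%N then Xe i b' t.-1 else 0) else gen_entry i j t.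

(** The degree argument shared by both truncations: [(x w, y w)] is the position where the
    permutation [w] meets the truncated row or column. A nonzero term would have total degree at
    most [s + tail d], which is less than [s + r]. *)
Lemma det_trunc_coef (g : 'I_n -> 'I_n -> nat -> S) (x y : 'S_n -> 'I_n) d r :
  (d <= n)%N -> (tail lam d < r)%N ->
  (forall (w : 'S_n) (mu : 'I_n -> nat), (forall j, g (w j) j (mu j) != 0) ->
     [/\ mu (x w) != 0%N, mu (y w) != 0%N, (mu (y w) <= s + sij (x w) (y w))%N
      & forall j, j != y w -> (mu j <= lm j)%N]) ->
  ((\det (zu_mx N g))`_(n - d))`_(s + r) = 0 :> S.
Proof.
move=> dn lt_r gP; rewrite det_zu_mx big1 // => mu /andP[]; rewrite card_zeros //.
move=> /eqP card_mu /eqP sum_mu; rewrite -det_tr /determinant big1 // => w _.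
apply/eqP; rewrite mulf_eq0 signr_eq0 /=; apply/prodf_eq0.
have [/existsP[j gj]|] := boolP [exists j, g (w j) j (mu j) == 0].
  by exists j; rewrite ?mxE.
rewrite negb_exists => /forallP /gP[mux muy le_y le_mu].
have := sum_mu_le lam_sorted mux muy le_y le_mu.
by rewrite card_mu sum_mu leq_add2l leqNgt lt_r.
Qed.

Lemma gen_entry_neq0 i j t : gen_entry i j t != 0 -> (t <= lm j)%N /\ (t = 0%N -> i = j).
Proof.
rewrite /gen_entry; case: (t =P 0%N) => [-> |t0]; first by case: (i =P j); rewrite ?eqxx.
by have [//|lt_j] := leqP t (lm j); rewrite Xe_ge ?eqxx //; lia.
Qed.

Lemma det_row_trunc d r : (d <= n)%N -> (tail lam d < r)%N ->
  ((\det (zu_mx N row_trunc))`_(n - d))`_(s + r) = 0.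
Proof.
move=> dn lt_r; apply: (det_trunc_coef (x := fun=> b') (y := fun w => (w^-1)%g b')) => //.
move=> w mu mu_neq0.
have at_y : (0 < mu ((w^-1)%g b') <= s + sij b' ((w^-1)%g b'))%N.
  by have := mu_neq0 ((w^-1)%g b'); rewrite permKV /row_trunc eqxx; case: ifP; rewrite ?eqxx.
have off_y j : j != (w^-1)%g b' -> gen_entry (w j) j (mu j) != 0.
  have := mu_neq0 j; rewrite /row_trunc; case: (w j =P b') => // <-.
  by rewrite permK eqxx.
split; try lia; last by move=> j /off_y/gen_entry_neq0[].
(* If [mu b'] were 0, column [b'] would contribute its diagonal [z], so [w] would fix [b'] and the
   truncated entry would lie in that same column, where the part is positive. *)
have [eq_b|/off_y/gen_entry_neq0[_ eq_b]] := eqVneq b' ((w^-1)%g b'); first by rewrite eq_b; lia.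
apply/eqP=> /[dup] mub /eq_b wb.
by move: at_y; rewrite -{1}wb permK mub.
Qed.

Lemma det_col_trunc d r : (d <= n)%N -> (tail lam d < r)%N ->
  ((\det (zu_mx N col_trunc))`_(n - d))`_(s + r) = 0.
Proof.
move=> dn lt_r; apply: (det_trunc_coef (x := fun w => w a) (y := fun=> a)) => //.
move=> w mu mu_neq0.
have at_y : (0 < mu a <= s + sij (w a) a)%N.
  by have := mu_neq0 a; rewrite /col_trunc eqxx; case: ifP; rewrite ?eqxx.
have off_y j : j != a -> gen_entry (w j) j (mu j) != 0.
  by have := mu_neq0 j; rewrite /col_trunc; case: (j =P a).
split; try lia; last by move=> j /off_y/gen_entry_neq0[].
have [->|/off_y/gen_entry_neq0[_ eq_w]] := eqVneq (w a) a; first lia.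
by apply/eqP=> /[dup] muw /eq_w /perm_inj wa; move: at_y; rewrite -{1}wa muw.
Qed.

Let D2 := map_poly (map_poly D).
Let dD2 : derivation D2 := derivation_map_poly (derivation_map_poly dD).
Let coefs (g : 'I_n -> 'I_n -> nat -> S) (i j : 'I_n) : {poly S} :=
  \poly_(t < N.+1) (if t == 0%N then 0 else g i j t).

Lemma coef_D2 p k r : ((D2 p)`_k)`_r = D (p`_k)`_r.
Proof. by rewrite !coef_map_id0 ?derivation0 //; apply: derivation_map_poly. Qed.

Lemma coefs_gen_entry i j t : (coefs gen_entry i j)`_t = if t == 0%N then 0 else Xe i j t.-1.
Proof.
rewrite coef_poly /gen_entry; case: eqP => [->|t0]; first by rewrite ltn0Sn.
by case: ltnP => // lt_t; rewrite Xe_ge //; have := lm_leN lam j; lia.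
Qed.

Lemma coefs_row_trunc j t :
  (coefs row_trunc b' j)`_t = if (0 < t <= s + sij b' j)%N then Xe a j t.-1 else 0.
Proof.
rewrite coef_poly /row_trunc eqxx; case: eqP => [->|t0]; first by [].
by case: ltnP => // lt_t; case: ifP => // _; rewrite Xe_ge //; have := lm_leN lam j; lia.
Qed.

Lemma coefs_col_trunc i t :
  (coefs col_trunc i a)`_t = if (0 < t <= s + sij i a)%N then Xe i b' t.-1 else 0.
Proof.
rewrite coef_poly /col_trunc eqxx; case: eqP => [->|t0]; first by [].
by case: ltnP => // lt_t; case: ifP => // _; rewrite Xe_ge //; have := lm_leN lam b'; lia.
Qed.

(** Compare coefficients of [u^t]. For [t <= s + sij i j] the left side is zero and the truncated
    entries on the right equal the full ones; for larger [t] the truncated entries vanish and the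
    bracket formula applies. *)
Lemma adS_coefs i j : 'X^s * map_poly D (coefs gen_entry i j) =
  (coefs gen_entry a j - coefs row_trunc b' j) *+ (i == b')
  - (coefs gen_entry i b' - coefs col_trunc i a) *+ (j == a).
Proof.
apply/polyP=> t; rewrite coefXnM coefB !coefMn !coefB coef_map_id0 ?derivation0 //.
rewrite !coefs_gen_entry coefs_row_trunc coefs_col_trunc.
have [t0|t_gt0] := posnP t; first by rewrite t0 !subr0 !mul0rn subr0; case: ltnP => //
   _; rewrite derivation0.
have [le_t|lt_t] := leqP t (s + sij i j).
  transitivity (0 : S).
    case: ltnP => // le_st; case: (t - s =P 0)%N => [_|ts]; first by rewrite derivation0.
    by rewrite Xe_lt ?derivation0 //; lia.
  have [ib|_] := eqVneq i b'; have [ja|_] := eqVneq j a;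
    rewrite -?ib -?ja ?le_t ?subrr ?mul0rn ?mulr0n ?subrr //.
rewrite ltnNge; have st : (s < t)%N by lia.
rewrite (ltnW st) /= gtn_eqF ?subn_gt0 //.
rewrite adS_Xe ?ltn_ord //; last lia.
rewrite -/s (_ : s + (t - s).-1 = t.-1)%N; last lia.
rewrite (_ : (bj b == i) = (i == b')); last by rewrite eq_sym.
rewrite (_ : (j == bi b :> nat) = (j == a)) //.
have lt_t' : (t <= s + sij i j)%N = false by apply/negbTE; lia.
congr (_ - _).
  have [ib|] := eqVneq i b'; last by rewrite !mulr0n.
  by rewrite -ib lt_t' subr0.
have [ja|] := eqVneq j a; last by rewrite !mulr0n.
by rewrite -ja lt_t' subr0.
Qed.

Lemma adS_det :
  ('X^s)%:P * D2 (\det (zu_mx N gen_entry)) =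
  \det (zu_mx N col_trunc) - \det (zu_mx N row_trunc).
Proof.
have gen_entryE k l : zu_mx N gen_entry k l = (coefs gen_entry k l)%:P + 'X *+ (k == l).
  by rewrite zu_mxE /gen_entry /= !polyC_natr mulr_natl addrC.
apply: (derivation_det_replace (z := 'X) (a := a) (b := b')
  (P := fun i j => (coefs gen_entry i j)%:P) (v := fun j => (coefs row_trunc b' j)%:P)
  (w := fun i => (coefs col_trunc i a)%:P) dD2) => [k l kb|j|k l la|i|//|i j].
- by apply: eq_zu_mx => t; rewrite /row_trunc (negPf kb).
- rewrite zu_mxE (_ : row_trunc b' j 0%N = 0) ?polyC0 ?mul0r ?add0r //.
  by rewrite /row_trunc eqxx.
- by apply: eq_zu_mx => t; rewrite /col_trunc (negPf la).
- rewrite zu_mxE (_ : col_trunc i a 0%N = 0) ?polyC0 ?mul0r ?add0r //.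
  by rewrite /col_trunc eqxx.
rewrite -!polyCB -!polyCMn -polyCB -adS_coefs polyCM gen_entryE dD2.1 derivationMn //.
by rewrite /D2 map_derivationX ?mul0rn ?addr0 ?map_derivationC //; apply: derivation_map_poly.
Qed.

Lemma adS_coef_det d r : (d <= n)%N -> (tail lam d < r)%N ->
  D (((\det (zu_mx N gen_entry))`_(n - d))`_r) = 0.
Proof.
have sub0 (p q : {poly {poly S}}) k m :
    (p`_k)`_m = 0 -> (q`_k)`_m = 0 -> ((p - q)`_k)`_m = 0.
  by move=> p0 q0; rewrite coefB coefB p0 q0 subrr.
(* The factor [u^s] moves the coefficient of [u^r] to exponent [s + r], out of reach of both
   truncated determinants. *)
move=> dn lt_r; have := congr1 (fun p : {poly {poly S}} => (p`_(n - d))`_(s + r)) adS_det.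
rewrite coefCM coefXnM ltnNge leq_addr addKn coef_D2 /= => ->.
exact: (sub0 _ _ _ _ (det_col_trunc dn lt_r) (det_row_trunc dn lt_r)).
Qed.

End Action.

Lemma xr_invariant r : (0 < r <= N)%N -> ge_invariant (xr F lam r).
Proof.
move=> r_N b; have [/andP[_ dn] lt_r _] := dr_bounds r_N.
by rewrite xr_coef // adS_coef_det.
Qed.

End Invariance.

(** * The slice *)

Section Slice.
Variables (F : fieldType) (lam : seq nat).
Hypothesis lam_gt0 : all (fun l => 0 < l)%N lam.
Hypothesis lam_sorted : sorted leq lam.
Local Notation n := (nrows lam).
Local Notation N := (Nsz lam).
Local Notation lm := (lm lam).
Local Notation sij := (sij lam).
Local Notation S := (Sge F lam).
Local Notation Xe := (Xe F lam).
Local Notation Xb := (Xb F).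
Local Notation Bidx := (Bidx lam).
Local Notation tail := (tail lam).

Lemma lm_gt0 i : (i < n)%N -> (0 < lm i)%N.
Proof. by move=> i_n; apply: (allP lam_gt0); rewrite mem_nth. Qed.

(* The slice is given by the values [base c] of the transverse coordinates. *)
Definition transverse (c : Bidx) : bool := ((bi c).+1 < n)%N.

Definition base (c : Bidx) : bool :=
  (bj c == (bi c).+1) && (br c == (lm (bj c)).-1).

(** Stated for any map [f] with [f 0 = 0], to cover both the restriction to the slice and the
    constant term of [scaled]. Positive parts make each index with base value 1 a genuine basis
    index. *)
Lemma Xe_base (A : nzRingType) (f : S -> A) i j t :
  f 0 = 0 -> (forall c, transverse c -> f (Xb c) = (base c)%:R) ->
  (i.+1 < n)%N -> (j < n)%N ->
  f (Xe i j t) = ((j == i.+1) && (t == (lm j).-1))%:R.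
Proof.
clear lam_sorted; move=> f0 fE i_n j_n; have [tb|ntb] := boolP (sij i j <= t < lm j)%N.
  have [c [ci cj ct]] := Bidx_exists (ltnW i_n) j_n tb.
  by rewrite -{1}ci -{1}cj -{1}ct Xe_Xb fE /transverse /base ?ci ?cj ?ct.
rewrite Xe_eq0 // f0; case: andP => // -[/eqP j_i /eqP t_j]; case/negP: ntb.
have := lm_gt0 (ltnW i_n); have := lm_gt0 j_n; rewrite /sij; lia.
Qed.

Lemma tail_succ d : (0 < d)%N -> tail d.+1 = (tail d + lm (n - d))%N.
Proof. by move=> d_gt0; rewrite /tail big_nat_recr. Qed.

Lemma leq_tail d e : (d <= e)%N -> (tail d <= tail e)%N.
Proof.
case: d => [|d] le_de; first by rewrite {1}/tail big_geq.
elim: e le_de => // e IHe; rewrite leq_eqVlt ltnS => /predU1P[-> //|lt_de].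
by rewrite (leq_trans (IHe lt_de)) // tail_succ ?leq_addr // (leq_ltn_trans _ lt_de).
Qed.

Lemma sum_tail d : (0 < d <= n)%N -> (\sum_((n - d).+1 <= i < n) lm i = tail d)%N.
Proof.
case: d => // d; elim: d => [|d IHd] d_n; first by rewrite /tail !big_geq // subn1; lia.
rewrite big_ltn; last lia.
rewrite (tail_succ (ltn0Sn d)).
have {1 2}-> : (n - d.+2).+1 = (n - d.+1)%N by lia.
by rewrite addnC IHd //; lia.
Qed.

(** The 0-based position of the x_r that restricts to this coordinate up to sign: with
    [d = n - bj c], it is [r - 1] for [r = tail d + br c + 1]. *)
Definition slice_index (c : Bidx) : nat := (tail (n - bj c) + br c)%N.

Lemma slice_index_lt c : (slice_index c < N)%N.
Proof.
have c_n := bj_lt c; have /andP[_ c_lt] := br_bounds c.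
have := @leq_tail (n - bj c).+1 n.+1; rewrite (@tail_succ (n - bj c)) ?subn_gt0 //.
rewrite (subKn (ltnW c_n)) tail_total ltnS leq_subr => /(_ isT).
by apply: leq_trans; rewrite ltn_add2l.
Qed.

Lemma bi_slice c : ~~ transverse c -> bi c = n.-1.
Proof. by rewrite /transverse -leqNgt => n_i; have := bi_lt c; lia. Qed.

(** The indices with second index [j] lie in the interval from [tail (n - j)] up to but excluding
    [tail (n - j).+1], and these intervals are disjoint. *)
Lemma slice_index_inj c d : ~~ transverse c -> ~~ transverse d ->
  slice_index c = slice_index d -> c = d.
Proof.
have lt_bj e f : (bj e < bj f)%N -> (slice_index f < slice_index e)%N.
  move=> lt_ef; have /andP[_ f_lt] := br_bounds f; have f_n := bj_lt f.
  have := @leq_tail (n - bj f).+1 (n - bj e); rewrite (@tail_succ (n - bj f)) ?subn_gt0 //.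
  rewrite (subKn (ltnW f_n)) /slice_index => /(_ _) tail_le.
  have : (tail (n - bj f) + lm (bj f) <= tail (n - bj e))%N by apply: tail_le; lia.
  lia.
move=> /bi_slice ci /bi_slice di cd.
have bjE : bj c = bj d.
  by case: (ltngtP (bj c) (bj d)) => // /lt_bj; rewrite cd ltnn.
apply: Bidx_inj => //; first by rewrite ci di.
by move: cd; rewrite /slice_index bjE => /addnI.
Qed.

(** The exponent of the sign in the companion determinant; building it into the coordinates makes
    each x_r restrict to a variable exactly. *)
Definition slice_sign (c : Bidx) : nat := n.-1 - bj c.

Definition slice_coord (c : Bidx) : {mpoly F[N]} :=
  if transverse c then (base c)%:R
  else (-1) ^+ slice_sign c * \sum_(r < N | val r == slice_index c) 'X_r.

Definition restrict : {rmorphism S -> {mpoly F[N]}} :=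
  mmap (@mpolyC N F) (fun k => slice_coord (enum_val k)).

Lemma restrict_Xb c : restrict (Xb c) = slice_coord c.
Proof. by rewrite /restrict /= mmapX mmap1U enum_rankK. Qed.

Lemma restrict_Xe i j t : (i.+1 < n)%N -> (j < n)%N ->
  restrict (Xe i j t) = ((j == i.+1) && (t == (lm j).-1))%:R.
Proof.
apply: (Xe_base (f := restrict)) => [|c ct]; first exact: rmorph0.
by rewrite restrict_Xb /slice_coord ct.
Qed.

Lemma restrict_Xe_last j t : (j < n)%N -> (t < lm j)%N ->
  restrict (Xe n.-1 j t) =
  (-1) ^+ (n.-1 - j) * \sum_(r < N | val r == (tail (n - j) + t)%N) 'X_r.
Proof.
move=> j_n t_j; have n_gt0 : (n.-1 < n)%N by lia.
have s0 : (sij n.-1 j <= t < lm j)%N.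
  by have := @leq_lm lam lam_sorted j n.-1; rewrite /sij t_j andbT; lia.
have [c [ci cj ct]] := Bidx_exists n_gt0 j_n s0.
rewrite -{1}ci -{1}cj -{1}ct Xe_Xb restrict_Xb /slice_coord /slice_sign /slice_index.
rewrite cj ct ifF //.
by rewrite /transverse ci; lia.
Qed.

Local Notation map2 := (map_poly (map_poly restrict)).

Definition last_row (j : nat) : {poly {mpoly F[N]}} :=
  \poly_(t < N.+1) (if t == 0%N then 0 else restrict (Xe n.-1 j t.-1)).

Lemma restrict_gen_entry (i j : 'I_n) :
  map2 (zu_mx N (@gen_entry F lam) i j) =
  'X *+ (i == j) + ('X^(lm j))%:P *+ (j == i.+1 :> nat)
  + (last_row j)%:P *+ (i.+1 == n).
Proof.
rewrite zu_mxE rmorphD rmorphM /= map_polyX !map_polyC /= map_polyC /= -addrA.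
congr (_ + _).
  by rewrite /gen_entry /= rmorph_nat !polyC_natr mulr_natl.
rewrite -!polyCMn -polyCD; congr (_%:P); apply/polyP=> t.
have -> : (map_poly restrict (\poly_(t < N.+1) if t == 0%N then 0 else gen_entry F i j t))`_t
    = if (t < N.+1)%N then if t == 0%N then 0 else restrict (gen_entry F i j t) else 0.
  by rewrite coef_map coef_poly; case: ifP => _; last exact: rmorph0; case: eqP => // _;
    exact: rmorph0.
rewrite coefD !coefMn coefXn coef_poly /gen_entry.
have := ltn_ord i; rewrite leq_eqVlt => /predU1P[i_n|i_n].
  have -> : n.-1 = i by apply: (congr1 predn (esym i_n)).
  rewrite i_n eqxx (ltn_eqF (ltn_ord j)) !mulrb add0r.
  by case: (t < N.+1)%N; [case: (t == 0%N)|]; exact: erefl.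
rewrite (ltn_eqF i_n) !mulrb addr0; have := lm_gt0 (ltn_ord j) => lm_j.
case: posnP => [->|t_gt0]; first by rewrite (ltn_eqF lm_j) !if_same.
rewrite restrict_Xe ?ltn_ord //; have := lm_leN lam j => lm_N.
(* The entry 1 has last index [lm j - 1], hence stands at [u^(lm j)]; the equivalence needs both [t]
   and [lm j] positive. *)
have -> : (t.-1 == (lm j).-1) = (t == lm j) by lia.
case: (ltnP t N.+1) => [_|lt_t]; first by case: (_ == i.+1); case: (t == lm j).
have -> : (t == lm j) = false by apply: gtn_eqF; apply: leq_trans lt_t.
by rewrite if_same.
Qed.

(** In the companion determinant [z^(n-d)] has coefficient [u^(tail d)] times the last-row entry in
    column [n - d], up to sign. Hence [u^(r+1)] reads off one last-row coordinate, the one of slice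
    index [r]. *)
Lemma restrict_xr (r : 'I_N) : restrict (xr F lam r.+1) = 'X_r.
Proof.
have r_N : (0 < r.+1 <= N)%N by rewrite ltn_ord.
have [/andP[d_gt0 d_n] lt_r r_le] := dr_bounds r_N.
set d := dr lam r.+1 in d_gt0 d_n lt_r r_le.
rewrite xr_coef // -/d -!coef_map /= -det_map_mx.
have -> : map_mx map2 (zu_mx N (@gen_entry F lam)) =
  \matrix_(i < n, j < n) ('X *+ (i == j) + ('X^(lm j))%:P *+ (j == i.+1 :> nat)
     + (last_row j)%:P *+ (i.+1 == n)).
  by apply/matrixP=> i j; rewrite [LHS]mxE restrict_gen_entry mxE.
rewrite (det_companion _ (fun j => ('X^(lm j))%:P) (fun j => (last_row j)%:P)); last lia.
rewrite coefD coefXn (_ : (n - d == n)%N = false) ?add0r; last lia.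
have nd_n : (n - d < n)%N by lia.
(* Only the summand [j = n - d] carries [z^(n-d)]. *)
rewrite coef_sum (bigD1 (Ordinal nd_n)) //= [X in _ + X]big1 ?addr0; last first.
  move=> j; rewrite -val_eqE /= => /negPf j_nd; rewrite -rmorph_prod mulrAC.
  by rewrite -[(-1) ^+ _](rmorph_sign polyC) -!polyCM coefCM coefXn eq_sym j_nd mulr0.
rewrite -rmorph_prod mulrAC -[(-1) ^+ _](rmorph_sign polyC) -!polyCM coefCM coefXn eqxx mulr1.
rewrite prodrXr sum_tail ?d_gt0 //.
rewrite coefMXn ltnNge (ltnW lt_r) /= -[(-1) ^+ _](rmorph_sign polyC) coefCM.
rewrite coef_poly.
have -> : (r.+1 - tail d < N.+1)%N by rewrite ltnS leq_subLR (leq_trans r_N) ?leq_addl.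
rewrite subn_eq0 leqNgt lt_r /= restrict_Xe_last //; last first.
  by move: r_le; rewrite (tail_succ d_gt0); lia.
(* The sign of the determinant meets the equal sign in [slice_coord]. *)
rewrite subKn // mulrA -expr2 sqrr_sign mul1r (big_pred1 r) // => i.
have -> // : (tail d + (r.+1 - tail d).-1)%N = r.
by rewrite -subn1 addnBA ?subn_gt0 // subnKC ?subn1 // ltnW.
Qed.

End Slice.

(** * Transversality of the slice to the coadjoint orbits *)

Section Transversality.
Variables (F : fieldType) (lam : seq nat).
Hypothesis lam_gt0 : all (fun l => 0 < l)%N lam.
Hypothesis lam_sorted : sorted leq lam.
Hypothesis char0 : [pchar F] =i pred0.
Local Notation n := (nrows lam).
Local Notation N := (Nsz lam).
Local Notation lm := (lm lam).
Local Notation sij := (sij lam).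
Local Notation S := (Sge F lam).
Local Notation Xe := (Xe F lam).
Local Notation Xb := (Xb F).
Local Notation Bidx := (Bidx lam).
Local Notation dX c := (mderiv (enum_rank c)).

(* The power of 'X is the order transverse to the slice. *)
Definition scaled_coord (c : Bidx) : {poly S} :=
  if transverse c then (base c)%:R + (Xb c)%:P * 'X else (Xb c)%:P.

Definition scaled : {rmorphism S -> {poly S}} :=
  mmap (polyC \o @mpolyC (dimge lam) F) (fun k => scaled_coord (enum_val k)).

Lemma scaled_Xb c : scaled (Xb c) = scaled_coord c.
Proof. by rewrite /scaled /= mmapX mmap1U enum_rankK. Qed.

Lemma scaledC c : scaled c%:MP = c%:MP%:P.
Proof. by rewrite /scaled /= mmapC. Qed.

(** At parameter 1 the scaling is a translation of the coordinates by [base], which is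
    invertible. *)
Lemma scaled_inj p : scaled p = 0 -> p = 0.
Proof.
pose unshift : {rmorphism S -> S} := mmap (@mpolyC (dimge lam) F)
  (fun k => Xb (enum_val k) - (base (enum_val k) && transverse (enum_val k))%:R).
pose back : {rmorphism S -> S} := unshift \o horner_eval 1 \o scaled.
suff backK q : back q = q.
  by move=> p0; rewrite -[p]backK /back /= p0 /horner_eval horner0 rmorph0.
apply: (eq_mpoly_rmorphism (f := back) (g := idfun)) => [c|i].
  by rewrite /back /= scaledC /horner_eval hornerC /unshift /= mmapC.
have XE c : unshift (Xb c) = Xb c - (base c && transverse c)%:R.
  by rewrite /unshift /= mmapX mmap1U enum_rankK.
have -> : 'X_i = Xb (enum_val i) by rewrite /Defs.Xb enum_valK.
rewrite /back /= /horner_eval scaled_Xb /scaled_coord; case: ifP => ct.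
  rewrite hornerD hornerMX hornerC mulr1 -polyC_natr hornerC rmorphD rmorph_nat XE.
  by rewrite ct andbT addrC subrK.
by rewrite hornerC XE ct andbF subr0.
Qed.

Lemma scaled_derivation (D : {poly S} -> {poly S}) : derivation D ->
  (forall a : F, D a%:MP%:P = 0) ->
  forall p, D (scaled p) = \sum_c scaled (dX c p) * D (scaled_coord c).
Proof.
move=> dD D0 p; rewrite /scaled (derivation_mmap _ dD) //.
rewrite (reindex (@enum_rank _)) /=; last first.
  by exists enum_val => i _; rewrite ?enum_rankK ?enum_valK.
by apply: eq_bigr => c _; rewrite enum_rankK.
Qed.

Lemma mderiv_derivation c : derivation (@mderiv _ F c : S -> S).
Proof. by split=> [p q|p q]; rewrite ?mderivD ?mderivM. Qed.

Lemma mderiv_Xb (c d : Bidx) : dX c (Xb d) = (c == d)%:R.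
Proof.
rewrite mderivX mnm1E (inj_eq enum_rank_inj) eq_sym; case: eqVneq => [->|_].
  by rewrite -{1}[U_(_)%MM]add0m addmK mpolyX0 scale1r.
by rewrite scale0r.
Qed.

Lemma map_mderiv_scaled (c : Bidx) p :
  map_poly (dX c) (scaled p) = scaled (dX c p) * (if transverse c then 'X else 1).
Proof.
have dD := derivation_map_poly (mderiv_derivation (enum_rank c)).
rewrite (scaled_derivation dD) => [|a]; last first.
  by rewrite map_derivationC ?mderivC //; apply: mderiv_derivation.
rewrite (bigD1 c) //= big1 ?addr0 => [|d dc].
  congr (_ * _); rewrite /scaled_coord; case: ifP => ct.
    rewrite dD.1 dD.2 -polyC_natr !map_derivationC ?map_derivationX;
      try exact: mderiv_derivation.
    by rewrite -mpolyC_nat mderivC mderiv_Xb eqxx add0r mul1r mulr0 addr0.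
  by rewrite map_derivationC ?mderiv_Xb ?eqxx //; apply: mderiv_derivation.
rewrite (_ : map_poly _ _ = 0) ?mulr0 // /scaled_coord; case: ifP => ct.
  rewrite dD.1 dD.2 -polyC_natr !map_derivationC ?map_derivationX;
      try exact: mderiv_derivation.
  by rewrite -mpolyC_nat mderivC mderiv_Xb eq_sym (negPf dc) mul0r mulr0 !addr0.
by rewrite map_derivationC ?mderiv_Xb 1?eq_sym ?(negPf dc) //; apply: mderiv_derivation.
Qed.

Lemma deriv_derivation (R : comNzRingType) : derivation (@deriv R).
Proof. by split=> [p q|p q]; rewrite ?derivD ?derivM. Qed.

(** Euler's formula for the transverse degree: only transverse coordinates depend on the
    parameter. *)
Lemma deriv_scaled p :
  (scaled p)^`() = \sum_(c | transverse c) scaled (dX c p) * (Xb c)%:P.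
Proof.
rewrite (scaled_derivation (deriv_derivation _)) => [|a]; last by rewrite derivC.
rewrite [RHS]big_mkcond; apply: eq_bigr => c _; rewrite /scaled_coord.
case: ifP => _; last by rewrite derivC mulr0.
by rewrite derivD derivM derivC derivX -polyC_natr derivC mulr1 mul0r !add0r.
Qed.

Lemma coef0_scaled_Xe i j t : (i.+1 < n)%N -> (j < n)%N ->
  (scaled (Xe i j t))`_0 = ((j == i.+1) && (t == (lm j).-1))%:R.
Proof.
apply: (Xe_base lam_gt0 (f := fun p => (scaled p)`_0)) => [|c ct].
  by rewrite rmorph0 coef0.
by rewrite scaled_Xb /scaled_coord ct coefD coefMX addr0 -polyC_natr coefC.
Qed.

(** Both terms of the bracket have their first index in a transverse row, so their values on the
    slice are constants: these are entries of the Kirillov form in transverse directions. *)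
Lemma coef0_scaled_bracket (b d : Bidx) : transverse b -> transverse d ->
  (scaled (lin (Eb F b *m Eb F d - Eb F d *m Eb F b)))`_0 =
  [&& bj b == bi d, bj d == (bi b).+1 & (br b + br d == (lm (bj d)).-1)%N]%:R
  - [&& bj d == bi b, bj b == (bi d).+1 & (br b + br d == (lm (bj b)).-1)%N]%:R.
Proof.
move=> bt dt.
have natb (p q : bool) : p%:R *+ q = (q && p)%:R :> S by case: p; case: q.
have scaledE x y (p q : bool) : (scaled (x *+ p - y *+ q))`_0 =
    (scaled x)`_0 *+ p - (scaled y)`_0 *+ q.
  by rewrite rmorphB !rmorphMn coefB !coefMn.
rewrite lin_bracket scaledE.
apply: (etrans (congr2 (fun x y : S => x *+ (bj b == bi d) - y *+ (bj d == bi b))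
  (coef0_scaled_Xe _ bt (bj_lt d)) (coef0_scaled_Xe _ dt (bj_lt b)))).
by rewrite !natb.
Qed.

Section LowestTerm.
Variables (g : S) (k : nat).
Hypothesis g_inv : ge_invariant g.
Hypothesis g_low : forall m, (m <= k)%N -> (scaled g)`_m = 0.
Let h := (scaled g)`_k.+1.

(** By the chain rule a transverse derivative lowers the transverse order by one, while a derivative
    along the slice preserves it. *)
Lemma coef_scaled_mderiv (c : Bidx) m : (m <= k)%N ->
  (scaled (dX c g))`_m = if transverse c then (if m == k then dX c h else 0) else 0.
Proof.
move=> le_mk; have E := map_mderiv_scaled c g; case: ifP E => ct E.
  have := congr1 (fun p : {poly S} => p`_m.+1) E.
  rewrite coefMX /= coef_map_id0 ?mderiv0 // => <-.
  case: eqP => [-> //|/eqP m_k].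
  by rewrite g_low ?mderiv0 // ltn_neqAle m_k.
by rewrite -[scaled _]mulr1 -E coef_map_id0 ?g_low ?mderiv0.
Qed.

(** This is the coefficient of order [k] in [scaled (adS b g) = 0]. The derivatives of [g] have no
    lower order, so only the constant terms of the brackets enter. *)
Lemma lowest_term_relation (b : Bidx) :
  \sum_(c | transverse c)
    dX c h * (scaled (lin (Eb F b *m Eb F c - Eb F c *m Eb F b)))`_0 = 0.
Proof.
pose L c : S := lin (Eb F b *m Eb F c - Eb F c *m Eb F b).
have sum0 : \sum_c (scaled (dX c g * L c))`_k = 0.
  by rewrite -coef_sum -(rmorph_sum scaled) (g_inv b : \sum_c dX c g * L c = 0) rmorph0 coef0.
rewrite big_mkcond; apply: etrans sum0; apply: eq_bigr => c _.
have low m : (m < k)%N -> (scaled (dX c g))`_m = 0.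
  move=> lt_mk; apply: etrans (coef_scaled_mderiv c (ltnW lt_mk)) _.
  by rewrite (ltn_eqF lt_mk) if_same.
rewrite (rmorphM scaled) (coefM_low _ low).
have at_k := coef_scaled_mderiv c (leqnn k); rewrite eqxx in at_k.
have := congr1 (fun x : S => x * (scaled (L c))`_0) (esym at_k).
by case: (transverse c) => /= <-; last exact/esym/mul0r.
Qed.

(* For c = (i, j; t), bracketing with e_{j-1,i;lambda_j-1-t} compares the derivative
   along c with those along indices in row i - 1. *)
Lemma mderiv_lowest_upper (c : Bidx) : transverse c -> (bi c < bj c)%N -> dX c h = 0.
Proof.
have [m] := ubnP (bi c); elim: m c => // m IHm c lt_m ct lt_ij.
have i_n : (bi c < n)%N := bi_lt c; have j_n : (bj c < n)%N := bj_lt c.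
have /andP[st tj] := br_bounds c.
have j1_n : ((bj c).-1 < n)%N by lia.
have sb : (sij (bj c).-1 (bi c) <= lm (bj c) - 1 - br c < lm (bi c))%N.
  have := @leq_lm lam lam_sorted (bi c) (bj c).-1.
  have := @leq_lm lam lam_sorted (bi c) (bj c).
  move: st; rewrite /sij; lia.
have [b [bE1 bE2 bE3]] := Bidx_exists j1_n i_n sb.
have bt : transverse b by rewrite /transverse bE1; lia.
have := lowest_term_relation b; rewrite (bigD1 c) // big1 => [|d /andP[dt dc]].
  rewrite coef0_scaled_bracket // bE1 bE2 bE3.
  rewrite (_ : [&& _, _ & _] = true); last by rewrite eqxx; lia.
  rewrite (_ : [&& _, _ & _] = false); last by apply/negbTE; lia.
  by rewrite subr0 mulr1 /= addr0.
rewrite coef0_scaled_bracket // bE1 bE2 bE3.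
rewrite (_ : [&& _, _ & _] = false); last first.
  apply: contraNF dc => /and3P[/eqP di /eqP dj /eqP dr].
  have djc : bj d = bj c by lia.
  by rewrite djc in dr; apply/eqP; apply: Bidx_inj; lia.
(* Any other surviving [d] has both indices one less than [c], so it is again above the diagonal and
   the induction applies. *)
rewrite sub0r; case: and3P => [[/eqP dj /eqP di _]|_]; last by rewrite oppr0 mulr0.
by rewrite (IHm d) ?mul0r //; lia.
Qed.

(* For c = (i, j; t), bracketing with e_{j,i+1;lambda_(i+1)-1-t} compares the
   derivative along c with those along indices in row i + 1. *)
Lemma mderiv_lowest_lower (c : Bidx) : transverse c -> (bj c <= bi c)%N -> dX c h = 0.
Proof.
have [m] := ubnP (n - bi c)%N; elim: m c => // m IHm c lt_m ct le_ji.
have j_n : (bj c < n)%N := bj_lt c.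
have /andP[_ tj] := br_bounds c; rewrite /transverse in ct.
have le_lm : (lm (bj c) <= lm (bi c).+1)%N by apply: leq_lm => //; lia.
have sb : (sij (bj c) (bi c).+1 <= lm (bi c).+1 - 1 - br c < lm (bi c).+1)%N.
  by rewrite /sij; lia.
have [b [bE1 bE2 bE3]] := Bidx_exists j_n ct sb.
have bt : transverse b by rewrite /transverse bE1; lia.
have := lowest_term_relation b; rewrite (bigD1 c) // big1 => [|d /andP[dt dc]].
  rewrite coef0_scaled_bracket // bE1 bE2 bE3.
  rewrite (_ : [&& _, _ & _] = false); last by apply/negbTE; lia.
  rewrite (_ : [&& _, _ & _] = true); last by rewrite !eqxx; lia.
  by rewrite sub0r mulrN1 /= addr0 => /eqP; rewrite oppr_eq0 => /eqP.
rewrite coef0_scaled_bracket // bE1 bE2 bE3.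
rewrite [X in _ - X](_ : _ = 0); last first.
  case: and3P => [[/eqP dj /eqP di /eqP dr]|_]; last exact: mulr0n.
  by case/eqP: dc; apply: Bidx_inj; lia.
(* Any other surviving [d] has both indices one more than [c], so it is again on or below the
   diagonal and nearer to the last row. *)
rewrite subr0; case: and3P => [[/eqP di /eqP dj _]|_]; last by rewrite mulr0.
by rewrite (IHm d) ?mul0r //; lia.
Qed.

(** Euler's formula expresses [k + 1] times [h] through its transverse derivatives, all zero;
    characteristic 0 allows the division. *)
Lemma lowest_term_eq0 : h = 0.
Proof.
have : (scaled g)^`()`_k = 0.
  rewrite deriv_scaled coef_sum big1 // => c ct.
  rewrite coefMC coef_scaled_mderiv // ct eqxx.
  have [le_ji|lt_ij] := leqP (bj c) (bi c).
    by rewrite mderiv_lowest_lower ?mul0r.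
  by rewrite mderiv_lowest_upper ?mul0r.
rewrite coef_deriv -/h -scaler_nat => /eqP; rewrite scaler_eq0 => /orP[|/eqP //].
by have /pcharf0P -> := char0.
Qed.

End LowestTerm.

Lemma scaled_invariant_eq0 g : ge_invariant g -> (scaled g)`_0 = 0 -> g = 0.
Proof.
move=> g_inv g0; apply: scaled_inj; apply/polyP=> k; rewrite coef0.
have [m] := ubnP k; elim: m k => // m IHm [|k] // lt_km.
apply: lowest_term_eq0 => // i le_ik; apply: IHm; lia.
Qed.

Lemma restrict_invariant_eq0 g : ge_invariant g -> restrict F lam g = 0 -> g = 0.
Proof.
move=> g_inv g0; apply: scaled_invariant_eq0 => //.
(* [embed] sends slice coordinates back to S(g_e), signs included, so that restriction followed by
   [embed] is [scaled] at parameter 0. *)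
pose embed : {rmorphism {mpoly F[N]} -> S} := mmap (@mpolyC (dimge lam) F)
  (fun r => \sum_(c : Bidx | ~~ transverse c && (slice_index c == val r))
     (-1) ^+ slice_sign c * Xb c).
have embedX r : embed 'X_r = \sum_(c : Bidx | ~~ transverse c && (slice_index c == val r))
     (-1) ^+ slice_sign c * Xb c by rewrite /embed /= mmapX mmap1U.
pose at0 : {rmorphism S -> S} := horner_eval 0 \o scaled.
have -> : (scaled g)`_0 = at0 g by rewrite -horner_coef0.
rewrite (eq_mpoly_rmorphism (f := at0) (g := embed \o restrict F lam)) => [|c|i].
- by rewrite /= g0 rmorph0.
- by rewrite /at0 /embed /restrict /= scaledC /horner_eval hornerC !mmapC.
have -> : 'X_i = Xb (enum_val i) by rewrite /Defs.Xb enum_valK.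
move: (enum_val i) => {i} c.
rewrite /= restrict_Xb scaled_Xb /scaled_coord /slice_coord /horner_eval.
case: ifPn => ct.
  by rewrite hornerD hornerMX mulr0 addr0 -polyC_natr hornerC rmorph_nat.
rewrite hornerC rmorphM rmorph_sign rmorph_sum.
have c_N := slice_index_lt c.
rewrite (big_pred1 (Ordinal c_N)) //= embedX (big_pred1 c) => [|d].
  by rewrite mulrA -expr2 sqrr_sign mul1r.
apply/andP/eqP => [[dt /eqP]|->]; last by rewrite ct.
exact: slice_index_inj.
Qed.

End Transversality.

(** * Polynomials in the x_r, and the conclusion *)

Lemma restrict_comp_xs (F : fieldType) (lam : seq nat) (P : {mpoly F[Nsz lam]}) :
  all (fun l => 0 < l)%N lam -> sorted leq lam ->
  restrict F lam (P \mPo xs F lam) = P.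
Proof.
move=> lam_gt0 lam_sorted.
pose roundtrip : {rmorphism {mpoly F[Nsz lam]} -> {mpoly F[Nsz lam]}} :=
  restrict F lam \o comp_mpoly (xs F lam).
apply: (eq_mpoly_rmorphism (f := roundtrip) (g := idfun)) => [c|r].
  by rewrite /roundtrip /= comp_mpolyC /restrict /= mmapC.
by rewrite /roundtrip /= comp_mpolyXU -tnth_nth tnth_mktuple restrict_xr.
Qed.

Lemma comp_xs_invariant (F : fieldType) (lam : seq nat) (P : {mpoly F[Nsz lam]}) :
  sorted leq lam -> ge_invariant (P \mPo xs F lam).
Proof.
move=> lam_sorted b.
rewrite /comp_mpoly (derivation_mmap _ (adS_derivation F b)) => [|c]; last exact: adSC.
rewrite big1 // => r _; rewrite tnth_mktuple.
by rewrite (@xr_invariant F lam lam_sorted r.+1) ?mulr0 //=.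
Qed.

Theorem theorem4p1 (F : closedFieldType) (lam : seq nat) :
  [pchar F] =i pred0 ->
  all (fun l => 0 < l)%N lam ->
  sorted leq lam ->
  (* x_1, ..., x_N lie in S(g_e)^{g_e} *)
  (forall r : 'I_(Nsz lam), ge_invariant (xr F lam r.+1)) /\
  (* they are algebraically independent *)
  (forall P : {mpoly F[Nsz lam]}, P \mPo xs F lam = 0 -> P = 0) /\
  (* they generate S(g_e)^{g_e} *)
  (forall f : Sge F lam, ge_invariant f ->
     exists P : {mpoly F[Nsz lam]}, f = P \mPo xs F lam).
Proof.
move=> char0 lam_gt0 lam_sorted; split; [|split] => [r|P P0|f f_inv].
- by apply: xr_invariant => //; rewrite ltn_ord.
- by rewrite -[P](restrict_comp_xs _ lam_gt0 lam_sorted) P0 rmorph0.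
(* The polynomial is the restriction of [f] itself: [f] minus its value at the x_r is an invariant
   vanishing on the slice. *)
exists (restrict F lam f); apply/eqP; rewrite -subr_eq0; apply/eqP.
apply: (restrict_invariant_eq0 lam_gt0 lam_sorted char0) => [b|].
  have dD := adS_derivation F b.
  by rewrite dD.1 derivationN // f_inv comp_xs_invariant // subrr.
by rewrite (rmorphB (restrict F lam)) restrict_comp_xs ?subrr.
Qed.
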